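(* Let $\Sigma$ be a signed graph with node set $[n]=\{1,\dots,n\}$ and let $P = [0,1]^n$. The Ehrhart quasipolynomials of $(P,\mathcal{H}''[\Sigma])$ satisfy $$(-1)^n E_{P,\mathcal{H}''[\Sigma]}(-t) = E^\circ_{P^\circ,\mathcal{H}''[\Sigma]}(t) = \begin{cases} \chi_\Sigma(t-1) &\text{if $t$ is even,} \\ \chi^*_\Sigma(t-1) &\text{if $t$ is odd.} \end{cases}$$
   Context: A signed graph $\Sigma=(\Gamma,\sigma)$ consists of a finite graph $\Gamma$ (multiple edges allowed) which may have links (two distinct endpoints), loops (two coinciding endpoints), halfedges (only one endpoint) and loose edges (no endpoints), and a signature $\sigma$ labelling each link and loop with a sign $+$ or $-$. For $\epsilon\in\{+,-\}$ (identified with $\pm1$) let $h_{ij}^\epsilon=\{x\in\mathbb{R}^n:x_j=\epsilon x_i\}$. The arrangement $\mathcal{H}[\Sigma]$ in $\mathbb{R}^n$ consists of the $h_{ij}^\epsilon$ for each edge $ij$ of $\Sigma$ with sign $\epsilon$, the hyperplanes $x_i=0$ for each node $i$ at which $\Sigma$ has a halfedge, and the degenerate hyperplane $\mathbb{R}^n$ if $\Sigma$ has a loose edge. (A positive loop also gives $h_{ii}^+=\mathbb{R}^n$, the degenerate hyperplane; when the degenerate hyperplane is present there are no regions.) $\mathcal{H}''[\Sigma]=\mathcal{H}[\Sigma]+\frac12(1,\dots,1)$ is the translate of $\mathcal{H}[\Sigma]$ obtained by adding $(\frac12,\dots,\frac12)$ to every hyperplane. A $c$-coloring of $\Sigma$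 is a function $x:[n]\to\{-c,\dots,-1,0,1,\dots,c\}$; it is proper if, as a point of $\mathbb{R}^n$, it lies in no hyperplane of $\mathcal{H}[\Sigma]$. For integers $c\ge 0$, $\chi_\Sigma(2c+1)$ is the number of proper $c$-colorings of $\Sigma$, and $\chi^*_\Sigma(2c)$ is the number of proper $c$-colorings not taking the value $0$; $\chi_\Sigma$ and $\chi^*_\Sigma$ are the polynomials determined by these values (the chromatic polynomial and the zero-free chromatic polynomial). A closed region of $(P,\mathcal{H})$ is the closure of a connected component of $P\setminus\bigcup\mathcal{H}$. For $x\in\mathbb{R}^n$, $m_{P,\mathcal{H}}(x)$ is the number of closed regions of $(P,\mathcal{H})$ containing $x$ if $x\in P$, and $0$ otherwise. $P^\circ$ is the interior of $P$. For positive integers $t$, $$E_{P,\mathcal{H}}(t)=\sum_{x\in t^{-1}\mathbb{Z}^n}m_{P,\mathcal{H}}(x),\qquad E^\circ_{P^\circ,\mathcal{H}}(t)=\#\bigl(t^{-1}\mathbb{Z}^n\cap[P^\circ\setminus\textstyle\bigcup\mathcal{H}]\bigr).$$ These are quasipolynomials in $t$ (functions $\sum_i c_i(t)t^i$ with $c_i$ periodic in the integer $t$), and are extended as such to all integers; this gives meaning to $E_{P,\mathcal{H}''[\Sigma]}(-t)$. *)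

(* Defs.v *)
From HB Require Import structures.
From mathcomp Require Import all_boot all_order all_algebra.
From mathcomp Require Import finmap.
From mathcomp Require Import all_classical all_reals all_analysis.

Set Implicit Arguments.
Unset Strict Implicit.
Unset Printing Implicit Defensive.

Import Order.TTheory GRing.Theory Num.Theory.
Import numFieldNormedType.Exports.

Local Open Scope classical_set_scope.
Local Open Scope ring_scope.

(* A sign is a boolean [s], standing for [(-1) ^+ s]: [false] is + and [true]
   is -. The two endpoints of a link are listed in an arbitrary order, which
   is irrelevant to [edge_hyperplane] since h_ij^s = h_ji^s. *)
Inductive signed_edge (n : nat) : Type :=
  | Link (i j : 'I_n) of i != j & bool
  | Loop of 'I_n & bool
  | Halfedge of 'I_n
  | Loose_edge.

Arguments Loose_edge {n}.

(* [edge_kind] need not be injective: multiple edges are allowed. *)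
Record signed_graph (n : nat) := SignedGraph {
  edge : finType;
  edge_kind : edge -> signed_edge n }.

Definition edge_hyperplane (R : realType) (n : nat) (e : signed_edge n) :
    set 'rV[R]_n :=
  match e with
  | Link i j _ s => [set x : 'rV[R]_n | x ord0 j = (-1) ^+ s * x ord0 i]
  | Loop i s => [set x : 'rV[R]_n | x ord0 i = (-1) ^+ s * x ord0 i]
  | Halfedge i => [set x : 'rV[R]_n | x ord0 i = 0]
  | Loose_edge => setT
  end.

Arguments edge_hyperplane R {n} e.

Definition arrangement (R : realType) (n : nat) (Sigma : signed_graph n) :
    set (set 'rV[R]_n) :=
  [set edge_hyperplane R (edge_kind e) | e in [set: edge Sigma]].

Arguments arrangement R {n} Sigma.

Definition shifted_arrangement (R : realType) (n : nat)
    (Sigma : signed_graph n) : set (set 'rV[R]_n) :=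
  [set [set x + const_mx 2^-1 | x in h] | h in arrangement R Sigma].

Arguments shifted_arrangement R {n} Sigma.

Definition unit_cube (R : realType) (n : nat) : set 'rV[R]_n :=
  [set x : 'rV[R]_n | forall i, 0 <= x ord0 i <= 1].

Arguments unit_cube R n : clear implicits.

(* Number of elements of a finite set; [fset_set] sends infinite sets to the
   empty set, but only finite sets are counted below. *)
Definition card_set (T : choiceType) (A : set T) : nat := #|` fset_set A|.

Section InsideOut.
Variables (R : realType) (n : nat).
Implicit Types (P : set 'rV[R]_n) (H : set (set 'rV[R]_n)).

Definition union_arr H : set 'rV[R]_n := \bigcup_(h in H) h.

Definition closed_regions P H : set (set 'rV[R]_n) :=
  let A := P `\` union_arr H in
  [set closure (connected_component A x) | x in A].

Definition multiplicity P H (x : 'rV[R]_n) : nat :=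
  if x \in P then card_set [set C | closed_regions P H C /\ C x] else 0%N.

(* t^{-1} Z^n *)
Definition lattice (t : nat) : set 'rV[R]_n :=
  [set x | exists z : 'rV[int]_n, x = t%:R^-1 *: map_mx intr z].

(* The sum is over the (finite) support of the multiplicity in the lattice. *)
Definition ehrhart P H (t : nat) : nat :=
  \sum_(x \in lattice t) multiplicity P H x.

Definition open_ehrhart P H (t : nat) : nat :=
  card_set (lattice t `&` (P^° `\` union_arr H)).

End InsideOut.

Definition quasipolynomial (q : int -> rat) : Prop :=
  exists (d : nat) (c : 'I_d -> int -> rat),
    (forall i, exists2 p : nat, (0 < p)%N & forall t, c i (t + p%:Z) = c i t) /\
    (forall t, q t = \sum_(i < d) c i t * t%:~R ^+ i).

(* [q] is the quasipolynomial whose values at positive integers are given by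
   [f]; these values determine [q] on all of [int]. *)
Definition quasipolynomial_of (f : nat -> nat) (q : int -> rat) : Prop :=
  quasipolynomial q /\ (forall t : nat, (0 < t)%N -> q t%:Z = (f t)%:R).

Section Coloring.
Variables (R : realType) (n : nat) (Sigma : signed_graph n).

Definition coloring (c : nat) : set {ffun 'I_n -> int} :=
  [set x : {ffun 'I_n -> int} | forall i, - c%:Z <= x i <= c%:Z].

Definition proper_coloring (x : {ffun 'I_n -> int}) : Prop :=
  ~ union_arr (arrangement R Sigma) (\row_i (x i)%:~R).

Definition zero_free (x : {ffun 'I_n -> int}) : Prop := forall i, x i != 0.

Definition chromatic_polynomial (chi : {poly rat}) : Prop :=
  forall c : nat, chi.[(2 * c + 1)%:R] =
    (card_set [set x : {ffun 'I_n -> int} | coloring c x /\ proper_coloring x])%:R.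

Definition zero_free_chromatic_polynomial (chi : {poly rat}) : Prop :=
  forall c : nat, chi.[(2 * c)%:R] =
    (card_set [set x : {ffun 'I_n -> int} | [/\ coloring c x, proper_coloring x & zero_free x]])%:R.

End Coloring.

(* Main.v *)
Require Import Defs.
From HB Require Import structures.
From mathcomp Require Import all_boot all_order all_algebra.
From mathcomp Require Import finmap.
From mathcomp Require Import all_classical all_reals all_analysis.
From mathcomp Require Import ring lra zify.

(** Translate the cube so that its centre, through which all the shifted
    hyperplanes pass, becomes the origin.  The points of t^-1 Z^n in the
    closed (open) cube become the points of S^n, where S is a finite set of
    reals with S = -S, of size t + 1 (resp. t - 1), and containing 0 exactly
    when t is even.  Colorings with colors -c, ..., c, with or without 0, are
    also points of such a grid, S having size 2c + 1 or 2c.  So the open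
    Ehrhart function and both chromatic polynomials count the points of S^n
    that avoid a list A of linear forms, and it suffices that this number
    depends only on |S| and on whether 0 is in S, as a polynomial in |S|
    for each of the two answers.

    The closed Ehrhart function is the sum over y in S^n of the number of
    regions of the central arrangement formed by the hyperplanes of A through y
    ([multiplicity_regions]).  Indeed a region of the cube corresponds to a sign
    vector of A; its closure contains x if and only if the signs agree with
    those of x on the forms that do not vanish at x; and moving slightly from x
    into a region of the local arrangement fixes all the other signs.

    [count_reciprocity] states that the two counts are p(|S|) and
    (-1)^n p(-|S|) for the same polynomial p.  It is proved by deletion and
    contraction.  If some form vanishes identically both counts are 0.  Otherwise
    let l be the first form and A' the list of the remaining ones.  The points
    avoiding l :: A' are those avoiding A', minus those of ker l avoiding A'.
    On the other side, adding l to an arrangement splits in two exactly the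
    regions that meet ker l ([regions_cut]), so the sum for l :: A' is the sum
    for A', plus the sum for the restriction of A' to ker l.  Solving l = 0 for
    one coordinate identifies S^n cut by ker l with S^(n-1), because S = -S, and
    turns the forms of A' into forms of the same kind in n - 1 variables.  The
    exception is l = 0 amounting to x_i = 0 when 0 is not in S: the contracted
    term then vanishes on both sides.  The two recurrences differ only in the
    sign of the second term, which (-1)^n and (-1)^(n-1) account for.

    Finally a quasipolynomial is determined by its values at positive integers
    ([quasipolynomial_unique]), so the identity extends to all integers. *)

Set Implicit Arguments.
Unset Strict Implicit.
Unset Printing Implicit Defensive.

Import Order.TTheory GRing.Theory Num.Theory.
Import numFieldNormedType.Exports.

Local Open Scope classical_set_scope.
Local Open Scope ring_scope.

(** * Forms of the edges of a signed graph *)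

(** [Some (i, false)] is x_i, [Some (i, true)] is - x_i, [None] is 0. *)
Definition signed_var (n : nat) : Type := option ('I_n * bool).

(** The pair (a, b) stands for the linear form a - b.  These forms include
    those of all edges and are closed under substituting a signed variable for a
    variable, which is what contraction does; and a - b vanishes identically
    exactly when a and b are the same signed variable. *)
Definition edge_form (n : nat) : Type := (signed_var n * signed_var n)%type.

Section Forms.
Variable R : realType.

Definition var_val n (x : 'rV[R]_n) (a : signed_var n) : R :=
  if a is Some (i, s) then (-1) ^+ s * x ord0 i else 0.

Definition form_val n (x : 'rV[R]_n) (l : edge_form n) : R :=
  var_val x l.1 - var_val x l.2.

Definition substitution m n (sg : 'I_n -> signed_var m) (x : 'rV[R]_m) : 'rV[R]_n :=
  \row_i var_val x (sg i).

Definition subst_var m n (sg : 'I_n -> signed_var m) (a : signed_var n) : signed_var m :=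
  if a is Some (i, s) then omap (fun p => (p.1, s (+) p.2)) (sg i) else None.

Definition subst_form m n (sg : 'I_n -> signed_var m) (l : edge_form n) : edge_form m :=
  (subst_var sg l.1, subst_var sg l.2).

Lemma form_val_subst m n (sg : 'I_n -> signed_var m) (x : 'rV[R]_m) (l : edge_form n) :
  form_val x (subst_form sg l) = form_val (substitution sg x) l.
Proof.
suff E a : var_val x (subst_var sg a) = var_val (substitution sg x) a.
  by rewrite /form_val /= !E.
case: a => [[i s]|] //=; rewrite mxE; case: (sg i) => [[j s']|] /=.
  by rewrite signr_addb mulrA.
by rewrite mulr0.
Qed.

Lemma form_val_conv n (x y : 'rV[R]_n) (a b : R) (l : edge_form n) :
  form_val (a *: x + b *: y) l = a * form_val x l + b * form_val y l.
Proof.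
suff E c : var_val (a *: x + b *: y) c = a * var_val x c + b * var_val y c.
  by rewrite /form_val !E; ring.
by case: c => [[i s]|] /=; rewrite ?mxE; ring.
Qed.

Lemma form_valZ n (x : 'rV[R]_n) (a : R) (l : edge_form n) :
  form_val (a *: x) l = a * form_val x l.
Proof. by have := form_val_conv x x a 0 l; rewrite scale0r mul0r !addr0. Qed.

Lemma form_valD n (x y : 'rV[R]_n) (l : edge_form n) :
  form_val (x + y) l = form_val x l + form_val y l.
Proof. by have := form_val_conv x y 1 1 l; rewrite !scale1r !mul1r. Qed.

Lemma form_val_continuous n (l : edge_form n) :
  continuous (fun x : 'rV[R]_n => form_val x l).
Proof.
suff E a : continuous (fun x : 'rV[R]_n => var_val x a).
  by move=> x; exact: (continuousB (E l.1 x) (E l.2 x)).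
case: a => [[i s]|] x /=; last exact: cst_continuous.
apply: (@continuousM _ _ (fun=> (-1) ^+ s) (fun x : 'rV_n => x ord0 i)).
  exact: cst_continuous.
exact: coord_continuous.
Qed.

(** A form x_i + x_i, from a negative loop, is solved by x_i = 0. *)
Lemma form_solve n (l : edge_form n.+1) : l.1 != l.2 ->
  exists (i : 'I_n.+1) (a : signed_var n), forall x : 'rV[R]_n.+1,
    (form_val x l == 0) = (x ord0 i == var_val (\row_k x ord0 (lift i k)) a).
Proof.
have sgn (s : bool) (u : R) : ((-1) ^+ s * u == 0) = (u == 0).
  by rewrite mulf_eq0 signr_eq0.
case: l => [[[i s]|] [[j t]|]]; rewrite /form_val //=.
- have [<-{j} neq|ij _] := eqVneq i j.
    exists i, None => x /=.
    have -> : t = ~~ s by move: neq; case: s; case: t => //; rewrite eqxx.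
    rewrite -(sgn s (x ord0 i)) signrN mulNr opprK.
    by rewrite -mulr2n mulrn_eq0.
  exists i.
  have /(unlift_some (i := j)) [k jk _] : i != j by [].
  exists (Some (k, s (+) t)) => x /=.
  have s0 : (-1) ^+ s != 0 :> R by rewrite signr_eq0.
  rewrite mxE -jk subr_eq0 -[RHS](inj_eq (mulfI s0)).
  by rewrite mulrA -signr_addb addbA addbb addFb.
- by move=> _; exists i, None => x /=; rewrite subr0 sgn.
- by move=> _; exists j, None => x /=; rewrite sub0r oppr_eq0 sgn.
Qed.

(** With the other coordinates set to 0, the solved equation reads x_i = 0,
    which fails at x_i = 1. *)
Lemma form_neq0 n (l : edge_form n) : l.1 != l.2 ->
  exists x : 'rV[R]_n, form_val x l != 0.
Proof.
case: n l => [[[[[]//]|] [[[]//]|]]//|n l /form_solve [i [a ia]]].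
pose x : 'rV[R]_n.+1 := \row_k (k == i)%:R.
exists x; rewrite ia mxE eqxx.
suff -> : \row_k x ord0 (lift i k) = 0.
  by case: a {ia} => [[j s]|] /=; rewrite ?mxE ?mulr0 oner_eq0.
by apply/rowP => k; rewrite !mxE [lift _ _ == _]eq_sym (negPf (neq_lift _ _)).
Qed.

(** * Regions as sign vectors *)

(** The sign vectors of [A] at the points of [P] lying on no hyperplane of [A].
    For a convex [P] these label the regions that [A] cuts [P] into.  The
    recursion on [A] makes deletion and restriction arguments direct. *)
Fixpoint sign_vectors n (A : seq (edge_form n)) (P : set 'rV[R]_n) : seq (seq bool) :=
  if A is l :: A' then
    map (cons true) (sign_vectors A' (P `&` [set x | 0 < form_val x l])) ++
    map (cons false) (sign_vectors A' (P `&` [set x | form_val x l < 0]))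
  else if `[< P !=set0 >] then [:: [::]] else [::].

Definition regions n (A : seq (edge_form n)) (P : set 'rV[R]_n) : nat :=
  size (sign_vectors A P).

Lemma regions_cons n l (A : seq (edge_form n)) P :
  regions (l :: A) P = regions A (P `&` [set x | 0 < form_val x l]) +
                       regions A (P `&` [set x | form_val x l < 0]).
Proof. by rewrite /regions /= size_cat !size_map. Qed.

Lemma regions_set0 n (A : seq (edge_form n)) : regions A set0 = 0%N.
Proof.
elim: A => [|l A IH]; last by rewrite regions_cons !set0I IH.
by rewrite /regions /=; case: asboolP => // -[].
Qed.

Definition signs n (A : seq (edge_form n)) (x : 'rV[R]_n) : seq bool :=
  [seq 0 < form_val x l | l <- A].

Definition avoids n (A : seq (edge_form n)) (x : 'rV[R]_n) : bool :=
  all (fun l => form_val x l != 0) A.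

Lemma sign_vectorsP n (A : seq (edge_form n)) P s :
  reflect (exists w, [/\ P w, avoids A w & s = signs A w])
          (s \in sign_vectors A P).
Proof.
elim: A P s => [|l A IH] P s /=.
  case: asboolP => [P0|P0]; rewrite ?inE.
    by apply: (iffP eqP) => [->|[? []]//]; case: P0 => w; exists w.
  by constructor => -[w [Pw]]; case: P0; exists w.
rewrite mem_cat; apply: (iffP orP) => [[]/mapP[s' /IH[w [[Pw lw] Aw ->]] ->]|].
- by exists w; split=> //=; rewrite ?lt0r_neq0 ?lw.
- by exists w; split=> //=; rewrite ?ltr0_neq0 // ltNge ltW.
- case=> w [Pw /andP[lw Aw] ->] /=.
  have [l0|l0|l0] := ltgtP 0 (form_val w l).
  + by left; apply/mapP; exists (signs A w) => //; apply/IH; exists w.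
  + by right; apply/mapP; exists (signs A w) => //; apply/IH; exists w.
  + by rewrite -l0 eqxx in lw.
Qed.

Lemma sign_vectors_uniq n (A : seq (edge_form n)) P : uniq (sign_vectors A P).
Proof.
elim: A P => [|l A IH] P /=; first by case: asboolP.
rewrite cat_uniq !map_inj_uniq ?IH ?andbT /=; try by move=> ? ? [].
by apply/hasPn => _ /mapP[s _ ->]; apply/mapP => -[s' _].
Qed.

Definition convex n (P : set 'rV[R]_n) : Prop :=
  forall x y a b, P x -> P y -> 0 <= a -> 0 <= b -> a + b = 1 ->
  P (a *: x + b *: y).

Lemma convexI n (P Q : set 'rV[R]_n) : convex P -> convex Q -> convex (P `&` Q).
Proof.
by move=> cP cQ x y a b [Px Qx] [Py Qy] *; split; [apply: cP|apply: cQ].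
Qed.

Lemma convex_pos n (l : edge_form n) : convex [set x | 0 < form_val x l].
Proof.
move=> x y a b /= lx ly a0 b0 ab; rewrite form_val_conv.
have [a1|a1] := ltP 0 a.
  by rewrite ltr_pwDl ?mulr_gt0 // mulr_ge0 // ltW.
have a_0 : a = 0 by lra.
rewrite a_0 in ab *; have -> : b = 1 by lra.
by rewrite mul0r mul1r add0r.
Qed.

Lemma open_pos n (l : edge_form n) : open [set x : 'rV[R]_n | 0 < form_val x l].
Proof.
have -> : [set x : 'rV[R]_n | 0 < form_val x l] =
  (fun x => form_val x l) @^-1` [set y | 0 < y] by [].
by apply: open_comp; [move=> x _; exact: form_val_continuous|exact: open_gt].
Qed.

Lemma neg_pos n (l : edge_form n) : [set x : 'rV[R]_n | form_val x l < 0] =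
  [set x | 0 < form_val x (l.2, l.1)].
Proof.
by apply/seteqP; split=> x; rewrite /form_val /= subr_lt0 subr_gt0.
Qed.

Lemma line_continuous n (w v : 'rV[R]_n) : continuous (fun e : R => w + e *: v).
Proof.
move=> e; apply: cvgD; first exact: cvg_cst.
by apply: cvgZr_tmp; exact: cvg_id.
Qed.

Lemma near_line n (x v : 'rV[R]_n) (P : set 'rV[R]_n) : nbhs x P ->
  exists2 d : R, 0 < d & forall e, `|e| <= d -> P (x + e *: v).
Proof.
rewrite -[X in nbhs X](addr0 x) -(scale0r v) => /line_continuous.
move=> /nbhs_ballP[d /= d0 dP]; exists (d / 2) => [|e ed]; first lra.
by apply: dP; rewrite /ball /= sub0r normrN; lra.
Qed.

(** Adding the hyperplane l = 0 to an arrangement splits in two the regions that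
    it meets.  By induction on [A], cutting [P] into open convex pieces, this
    reduces to the case where [P] is itself a region: a point of [P] on the
    hyperplane can be pushed to either side since [P] is open, and a segment
    between points on opposite sides crosses the hyperplane. *)
Lemma regions_cut n l (A : seq (edge_form n)) (P : set 'rV[R]_n) :
  open P -> convex P -> l.1 != l.2 ->
  regions A (P `&` [set x | 0 < form_val x l]) +
  regions A (P `&` [set x | form_val x l < 0]) =
  regions A P + regions A (P `&` [set x | form_val x l = 0]).
Proof.
move=> oP cP /form_neq0 [v lv].
elim: A P oP cP => [|m A IH] P oP cP; last first.
  rewrite !regions_cons.
  have IHp := IH _ (openI oP (@open_pos _ m)) (convexI cP (@convex_pos _ m)).
  have IHn := IH _ (openI oP (@open_pos _ _)) (convexI cP (@convex_pos _ (m.2, m.1))).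
  rewrite -neg_pos in IHn.
  rewrite !(setIAC P [set x | 0 < form_val x l]).
  rewrite !(setIAC P [set x | form_val x l < 0]) addrACA IHp IHn addrACA.
  by rewrite !(setIAC P [set x | form_val x l = 0]).
rewrite /regions /=.
have [[x [Px /= lx]]|P0] := pselect (P `&` [set x | form_val x l = 0] !=set0).
  have [|d d0 dP] := @near_line _ x v P; first exact: open_nbhs_nbhs.
  have Pp : P (x + d *: v) by apply: dP; rewrite gtr0_norm.
  have Pn : P (x + (- d) *: v) by apply: dP; rewrite normrN gtr0_norm.
  have vp : form_val (x + d *: v) l = d * form_val v l.
    by rewrite form_valD lx form_valZ add0r.
  have vn : form_val (x + (- d) *: v) l = - d * form_val v l.
    by rewrite form_valD lx form_valZ add0r.
  have Hp : P `&` [set y | 0 < form_val y l] !=set0.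
    have [v0|v0|v0] := ltgtP (form_val v l) 0; last by rewrite v0 eqxx in lv.
      by exists (x + (- d) *: v); split => //=; rewrite vn; nra.
    by exists (x + d *: v); split => //=; rewrite vp; nra.
  have Hn : P `&` [set y | form_val y l < 0] !=set0.
    have [v0|v0|v0] := ltgtP (form_val v l) 0; last by rewrite v0 eqxx in lv.
      by exists (x + d *: v); split => //=; rewrite vp; nra.
    by exists (x + (- d) *: v); split => //=; rewrite vn; nra.
  have HP : P !=set0 by exists x.
  have H0 : P `&` [set y | form_val y l = 0] !=set0 by exists x.
  by rewrite (asboolT Hp) (asboolT Hn) (asboolT HP) (asboolT H0).
rewrite [in RHS](asboolF P0) /= addr0.
case: asboolP => [[x [Px /= lx]]|Np]; case: asboolP => [[y [Py /= ly]]|Nn];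
  case: asboolP => [PN|PN] //=.
- (* the point where the segment from x to y meets the hyperplane *)
  case: P0; have xy : 0 < form_val x l - form_val y l by lra.
  exists ((- form_val y l / (form_val x l - form_val y l)) *: x +
          (form_val x l / (form_val x l - form_val y l)) *: y); split.
    apply: cP => //; [apply: divr_ge0; lra|apply: divr_ge0; lra|].
    by field; lra.
  by rewrite /= form_val_conv; field; lra.
- by case: PN; exists x.
- by case: PN; exists x.
- by case: PN; exists y.
- case: PN => x Px; have [lx|lx|lx] := ltgtP (form_val x l) 0.
  + by case: Nn; exists x.
  + by case: Np; exists x.
  + by case: P0; exists x.
Qed.

(** Contracted forms on the smaller space have the same regions as the original
    forms on the subspace that the substitution parametrizes. *)
Lemma regions_subst m n (sg : 'I_n -> signed_var m) (A : seq (edge_form n)) P :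
  regions [seq subst_form sg l | l <- A] (substitution sg @^-1` P) =
  regions A (P `&` range (substitution sg)).
Proof.
elim: A P => [|l A IH] P.
  rewrite /regions /=; congr (size (if _ then _ else _)).
  apply/asbool_equiv_eq; split=> [[x Px]|[y [Py [x _ xy]]]].
    by exists (substitution sg x); split => //; exists x.
  by exists x; rewrite /preimage /= xy.
rewrite [map _ _]/= !regions_cons !(setIAC P (range _)) -!IH.
by congr (_ + _); congr (regions _ _); apply/seteqP; split=> x /=;
   rewrite form_val_subst.
Qed.

End Forms.

(** * Reciprocity on symmetric grids *)

Section Reciprocity.
Variable R : realType.

Definition grid n (S : seq R) : set 'rV[R]_n :=
  [set y | forall i, y ord0 i \in S].
Arguments grid n S : clear implicits.

Lemma grid_bij n (S : seq R) : set_bij [set: {ffun 'I_n -> seq_sub S}] (grid n S)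
  (fun f => \row_i ssval (f i)).
Proof.
split=> [f _ i|f g _ _ fg|y Sy]; first by rewrite mxE ssvalP.
- by apply/ffunP => i; apply/val_inj; have /rowP/(_ i) := fg; rewrite !mxE.
- exists [ffun i => SeqSub (Sy i)] => //.
  by apply/rowP => i; rewrite mxE ffunE.
Qed.

Lemma finite_grid n (S : seq R) : finite_set (grid n S).
Proof.
have [_ _ surj] := grid_bij n S.
apply: (sub_finite_set surj); apply: finite_image; exact: finite_finset.
Qed.

Lemma grid_split n (S : seq R) (Z : set 'rV[R]_n) (w : 'rV[R]_n -> nat) :
  \sum_(y \in grid n S) w y =
  \sum_(y \in grid n S `&` Z) w y + \sum_(y \in grid n S `&` ~` Z) w y.
Proof. by rewrite [LHS](fsbigID Z) //; exact: finite_grid. Qed.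

Lemma grid_sumD n (S : seq R) (v w : 'rV[R]_n -> nat) :
  \sum_(y \in grid n S) (v y + w y) =
  \sum_(y \in grid n S) v y + \sum_(y \in grid n S) w y.
Proof. by rewrite [LHS]fsbig_split //; exact: finite_grid. Qed.

Lemma card_grid n (S : seq R) : uniq S -> \sum_(y \in grid n S) 1%N = (size S ^ n)%N.
Proof.
move=> uS; rewrite (reindex_fsbig _ _ _ _ (grid_bij n S)).
rewrite (fsbigE (enum {: {ffun 'I_n -> seq_sub S}})) ?enum_uniq //; last first.
  by move=> f _; rewrite mem_enum.
rewrite big_enum_cond (eq_bigl xpredT) => [|f]; last by rewrite in_setT.
rewrite sumr_const.
by rewrite card_ffun card_ord card_seq_sub // natn.
Qed.

Definition open_count n (S : seq R) (A : seq (edge_form n)) : nat :=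
  \sum_(y \in grid n S) (avoids A y : nat).

(** Each point is weighted by the number of regions of the arrangement of the
    hyperplanes through it, which is the number of closed regions containing it:
    near the point, no other hyperplane separates anything. *)
Definition closed_count n (S : seq R) (A : seq (edge_form n)) : nat :=
  \sum_(y \in grid n S) regions [seq l <- A | form_val y l == 0] (setT : set 'rV[R]_n).

Lemma var_val_grid n (S : seq R) (y : 'rV[R]_n) (a : signed_var n) :
  {in S, forall s, - s \in S} -> grid n S y -> a != None \/ 0 \in S ->
  var_val y a \in S.
Proof.
move=> symS Sy; case: a => [[i s] _|[]//] /=.
by case: s; rewrite ?mul1r // expr1 mulN1r symS.
Qed.

(** The substitution that parametrizes the hyperplane x_i = a, where [a] is
    written in terms of the coordinates other than i. *)
Definition solution n (i : 'I_n.+1) (a : signed_var n) (k : 'I_n.+1) : signed_var n :=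
  if unlift i k is Some k' then Some (k', false) else a.

Section Solve.
Variables (n : nat) (l : edge_form n.+1) (i : 'I_n.+1) (a : signed_var n).
Hypothesis ia : forall x : 'rV[R]_n.+1,
  (form_val x l == 0) = (x ord0 i == var_val (\row_k x ord0 (lift i k)) a).

Lemma solution_lift (x : 'rV[R]_n) k :
  substitution (solution i a) x ord0 (lift i k) = x ord0 k.
Proof. by rewrite mxE /solution liftK /= expr0 mul1r. Qed.

Lemma solution_at (x : 'rV[R]_n) :
  substitution (solution i a) x ord0 i = var_val x a.
Proof. by rewrite mxE /solution unlift_none. Qed.

Lemma solutionK :
  cancel (substitution (solution i a)) (fun y : 'rV[R]_n.+1 => \row_k y ord0 (lift i k)).
Proof. by move=> x; apply/rowP => k; rewrite mxE solution_lift. Qed.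

Lemma solution_inv (y : 'rV[R]_n.+1) : form_val y l = 0 ->
  substitution (solution i a) (\row_k y ord0 (lift i k)) = y.
Proof.
move=> /eqP; rewrite ia => /eqP yi; apply/rowP => j.
have [k ->|->] := unliftP i j; first by rewrite solution_lift mxE.
by rewrite solution_at yi.
Qed.

Lemma solution_zero (x : 'rV[R]_n) :
  form_val (substitution (solution i a) x) l = 0.
Proof. by apply/eqP; rewrite ia solution_at solutionK. Qed.

Lemma range_solution :
  range (substitution (solution i a)) = [set y : 'rV[R]_n.+1 | form_val y l = 0].
Proof.
apply/seteqP; split=> [_ [x _ <-]|y /= y0]; first exact: solution_zero.
by exists (\row_k y ord0 (lift i k)) => //; exact: solution_inv.
Qed.

(** The coordinate x_i given by the equation lies in [S] again: it is plus or
    minus another coordinate, or 0.  This is where S = -S is needed. *)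
Lemma solution_bij (S : seq R) :
  {in S, forall s, - s \in S} -> a != None \/ 0 \in S ->
  set_bij (grid n S) (grid n.+1 S `&` [set y | form_val y l = 0])
    (substitution (solution i a)).
Proof.
move=> symS aS; split=> [x Sx|x y _ _ xy|y [Sy y0]].
- split; last exact: solution_zero.
  move=> j; have [k ->|->] := unliftP i j; first by rewrite solution_lift.
  by rewrite solution_at; exact: var_val_grid.
- exact: can_inj solutionK _ _ xy.
- exists (\row_k y ord0 (lift i k)); last exact: solution_inv.
  by move=> k; rewrite mxE.
Qed.

End Solve.

(** Deletion and contraction, as explained at the top of the file; [q] is the
    polynomial of the contraction, and [r] is its contribution, which is 0 when
    the hyperplane x_i = 0 misses the grid. *)
Theorem count_reciprocity n (A : seq (edge_form n)) (b : bool) :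
  exists p : {poly rat}, forall S : seq R,
    uniq S -> {in S, forall s, - s \in S} -> (0 \in S) = b ->
    (open_count S A)%:R = p.[(size S)%:R] /\
    (closed_count S A)%:R = (-1) ^+ n * p.[- (size S)%:R].
Proof.
have [k] := ubnP (size A); elim: k => // k IH in n A *.
case: A => [_|l A /ltnSE sA].
  exists 'X^n => S uS _ _.
  rewrite /open_count /closed_count !hornerXn -exprMn mulrNN mul1r.
  have r1 : regions [::] (setT : set 'rV[R]_n) = 1%N.
    by rewrite /regions /= asboolT //; exists 0.
  rewrite (eq_fsbigr (fun=> 1%N)) // [X in _ /\ X%:R = _](eq_fsbigr (fun=> 1%N)) //.
  by rewrite (card_grid n uS) natrX.
have [l0|l0] := eqVneq l.1 l.2.
  have lv (y : 'rV[R]_n) : form_val y l = 0 by rewrite /form_val l0 subrr.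
  exists 0 => S _ _ _; rewrite /open_count /closed_count !fsbig1 ?horner0 ?mulr0 //.
    move=> y _ /=; rewrite lv eqxx regions_cons.
    have -> : [set x : 'rV[R]_n | 0 < form_val x l] = set0.
      by apply/seteqP; split=> x //=; rewrite lv ltxx.
    have -> : [set x : 'rV[R]_n | form_val x l < 0] = set0.
      by apply/seteqP; split=> x //=; rewrite lv ltxx.
    by rewrite !setI0 regions_set0.
  by move=> y _ /=; rewrite lv eqxx.
case: n => [|n] in l A sA l0 *.
  by case: l l0 {sA} => [[[[]//]|] [[[]//]|]].
have [i [a ia]] := form_solve R l0.
have [p pP] := IH _ A sA.
have [q qP] := IH _ [seq subst_form (solution i a) m | m <- A]
                 (eq_ind_r (fun j => (j < k)%N) sA (size_map _ _)).
pose r := if (a == None) && ~~ b then 0 else q.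
exists (p - r) => S uS symS Sb.
have [pO pC] := pP S uS symS Sb; have [qO qC] := qP S uS symS Sb.
have cont (w : 'rV[R]_n.+1 -> nat) :
    \sum_(y \in grid n.+1 S `&` [set y | form_val y l = 0]) w y =
    if (a == None) && ~~ b then 0%N
    else \sum_(z \in grid n S) w (substitution (solution i a) z).
  case: ifPn => [/andP[/eqP a0 b0]|ab].
    apply: fsbig1 => y [Sy /= /eqP]; rewrite ia a0 /= => /eqP yi0.
    by case/negP: b0; rewrite -Sb -yi0.
  apply: reindex_fsbig; apply: (solution_bij ia) => //.
  by move: ab; rewrite negb_and negbK -Sb => /orP.
have oE : (open_count S A)%:R = (open_count S (l :: A))%:R + r.[(size S)%:R].
  rewrite /open_count (grid_split _ [set y | form_val y l = 0]).
  rewrite cont [X in _ = X%:R + _](grid_split _ [set y | form_val y l = 0]).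
  rewrite [X in _ = (X + _)%:R + _]fsbig1; last first.
    by move=> y [_ /= ->]; rewrite eqxx.
  rewrite !natrD mulr0n add0r addrC; congr (_ + _).
    by congr (_%:R); apply: eq_fsbigr => y; rewrite inE /= => -[_ /eqP ->].
  rewrite /r; case: ifP => _; first by rewrite horner0.
  rewrite -qO /open_count; congr (_%:R); apply: eq_fsbigr => y _.
  by rewrite /avoids all_map; congr nat_of_bool; apply: eq_all => m /=; rewrite form_val_subst.
have cE : (closed_count S (l :: A))%:R = (closed_count S A)%:R + (-1) ^+ n * r.[- (size S)%:R].
  rewrite /closed_count (grid_split _ [set y | form_val y l = 0]).
  rewrite cont [X in _ = X%:R + _](grid_split _ [set y | form_val y l = 0]).
  rewrite cont !natrD addrAC; congr (_ + _); last first.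
    by congr (_%:R); apply: eq_fsbigr => y; rewrite inE /= => -[_ /eqP/negPf ->].
  rewrite /r; case: ifPn => [_|ab]; first by rewrite horner0 mulr0 add0r.
  rewrite -qC /closed_count -natrD; congr (_%:R).
  apply: etrans (grid_sumD _ _ _); apply: eq_fsbigr => z Sz /=.
  set y := substitution _ z.
  have -> : form_val y l == 0.
    by apply/eqP; exact: solution_zero.
  rewrite regions_cons regions_cut //; last exact: openT.
  rewrite !setTI; congr (_ + _).
  rewrite -(range_solution ia) -[X in regions _ X]setTI -regions_subst preimage_setT.
  congr (regions _ _); rewrite filter_map; congr map.
  by apply: eq_filter => m /=; rewrite form_val_subst.
rewrite cE pC; rewrite pO in oE; split.
  by rewrite hornerD hornerN oE addrK.
by rewrite hornerD hornerN exprS; ring.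
Qed.
End Reciprocity.

Arguments grid {R} n S.

(** * Closed regions of the cube at a point *)

Section Geometry.
Variable R : realType.

Lemma card_set_seq (T : choiceType) (A : set T) (s : seq T) :
  uniq s -> (forall x, A x <-> x \in s) -> card_set A = size s.
Proof.
move=> us As; have -> : A = [set` s] by apply/seteqP; split=> x /As.
apply/perm_size/uniq_perm => // x.
by rewrite in_fset_set ?finite_seq //; apply/idP/idP; rewrite inE.
Qed.

Definition centre n : 'rV[R]_n := const_mx 2^-1.
Arguments centre n : clear implicits.

Lemma coord_open n (i : 'I_n) (U : set R) : open U ->
  open [set x : 'rV[R]_n | U (x ord0 i)].
Proof.
move=> oU; apply: (@open_comp _ _ (fun x : 'rV[R]_n => x ord0 i)) => // x _.
exact: coord_continuous.
Qed.

Lemma interior_unit_cube n :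
  (unit_cube R n)° = [set x : 'rV[R]_n | forall i, 0 < x ord0 i < 1].
Proof.
apply/seteqP; split=> x /=.
  move=> Px i.
  have [d d0 dP] := near_line (const_mx 1 : 'rV[R]_n) Px.
  have Pp : unit_cube R n (x + d *: const_mx 1).
    by apply: dP; rewrite gtr0_norm.
  have Pn : unit_cube R n (x + (- d) *: const_mx 1).
    by apply: dP; rewrite normrN gtr0_norm.
  have := Pp i; have := Pn i; rewrite !mxE => /andP[x0 _] /andP[_ x1].
  by apply/andP; split; lra.
move=> x01.
have : \forall y \near x, forall i, 0 < (y : 'rV[R]_n) ord0 i < 1.
  apply: (@filter_forall _ _ (fun i (y : 'rV[R]_n) => is_true (0 < y ord0 i < 1))
    _ (nbhs_filter x)) => i.
  apply: open_nbhs_nbhs; split => /=; last exact: x01.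
  have : open ([set y : 'rV[R]_n | [set u : R | 0 < u] (y ord0 i)] `&`
      [set y | [set u : R | u < 1] (y ord0 i)]).
    by apply: openI; apply: coord_open; [exact: open_gt|exact: open_lt].
  by congr open; apply/seteqP; split=> y /=; [case=> -> ->|case/andP].
by apply: filterS => y y01 i; have /andP[/ltW -> /ltW ->] := y01 i.
Qed.

Lemma convex_unit_cube n : convex (unit_cube R n).
Proof.
move=> x y a b Px Py a0 b0 ab i; rewrite !mxE.
have /andP[x0 x1] := Px i; have /andP[y0 y1] := Py i.
have bE : b = 1 - a by lra.
by rewrite addr_ge0 ?mulr_ge0 //= bE; nra.
Qed.

Lemma line_conv n (w z : 'rV[R]_n) (e : R) :
  w + e *: (z - w) = (1 - e) *: w + e *: z.
Proof. by apply/rowP => i; rewrite !mxE; ring. Qed.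

Definition offset_val n (z : 'rV[R]_n) (l : edge_form n) : R :=
  form_val (z - centre n) l.

Lemma offset_val_conv n (x y : 'rV[R]_n) (a b : R) l : a + b = 1 ->
  offset_val (a *: x + b *: y) l = a * offset_val x l + b * offset_val y l.
Proof.
move=> ab; rewrite -form_val_conv; congr form_val.
have -> : b = 1 - a by rewrite -ab addrAC subrr add0r.
by apply/rowP => i; rewrite !mxE; ring.
Qed.

Lemma offset_val_line n (w z : 'rV[R]_n) (e : R) l :
  offset_val (w + e *: (z - w)) l = (1 - e) * offset_val w l + e * offset_val z l.
Proof. by rewrite line_conv offset_val_conv // subrK. Qed.

Lemma offset_val_continuous n (l : edge_form n) :
  continuous (fun z : 'rV[R]_n => offset_val z l).
Proof.
move=> z; have Ez : {for z, continuous (fun u : 'rV[R]_n => u - centre n)}.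
  by apply: (@continuousB R _ _ id (fun=> centre n)); [exact: cvg_id|exact: cst_continuous].
exact: (continuous_comp Ez (@form_val_continuous R n l _)).
Qed.

Lemma near_same_side n (l : edge_form n) (x : 'rV[R]_n) : offset_val x l != 0 ->
  \forall z \near x, 0 < offset_val x l * offset_val z l.
Proof.
move=> x0; apply: open_nbhs_nbhs; split; last by rewrite -expr2 exprn_even_gt0.
apply: (@open_comp _ _ (fun z => offset_val x l * offset_val z l)
  [set u : R | 0 < u]); last exact: open_gt.
move=> z _; apply: (@continuousM _ _ (fun=> offset_val x l)
  (fun z => offset_val z l)); first exact: cst_continuous.
exact: offset_val_continuous.
Qed.

Lemma same_side (u v : R) : 0 < u * v -> (0 < u) = (0 < v).
Proof. by case: (ltgtP 0 u); case: (ltgtP 0 v) => //= ? ? ?; nra. Qed.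

Section Multiplicity.
Variables (n : nat) (A : seq (edge_form n)) (H : set (set 'rV[R]_n)).
Hypothesis HA : forall z, union_arr H z <-> ~~ avoids A (z - centre n).
Let D := unit_cube R n `\` union_arr H.

Lemma complementP z :
  D z <-> unit_cube R n z /\ {in A, forall l, offset_val z l != 0}.
Proof.
rewrite /D /setD /= HA; split=> -[Pz zA]; split=> //.
  by move: zA => /negP; rewrite negbK => /allP.
by apply/negP; rewrite negbK; apply/allP.
Qed.

Definition cell (w : 'rV[R]_n) : set 'rV[R]_n :=
  [set z | D z /\ {in A, forall l, (0 < offset_val z l) = (0 < offset_val w l)}].

(** Points with the same signs are joined by a segment of such points, as the
    cube is convex; and a form that takes both signs on a connected set vanishes
    somewhere on it. *)
Lemma component_cell w : D w -> connected_component D w = cell w.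
Proof.
move=> Dw; apply/seteqP; split=> z.
  case=> B [Bw BD cB] Bz; split=> [|l lA]; first exact: BD.
  have Bn0 u : B u -> offset_val u l != 0.
    by move=> /BD/complementP[_]; exact.
  have /connected_intervalP IB : connected ((fun u => offset_val u l) @` B).
    apply: connected_continuous_connected => //.
    by apply: continuous_subspaceT; exact: offset_val_continuous.
  have imB u : B u -> ((fun u => offset_val u l) @` B) (offset_val u l).
    by move=> Bu; exists u.
  have no0 u v : B u -> B v -> offset_val u l <= 0 <= offset_val v l -> False.
    move=> Bu Bv uv; have [t Bt t0] := IB _ _ (imB _ Bu) (imB _ Bv) 0 uv.
    by have := Bn0 _ Bt; rewrite t0 eqxx.
  case: (ltP 0 (offset_val z l)) => zl; case: (ltP 0 (offset_val w l)) => wl //.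
    by exfalso; apply: (no0 w z); rewrite // wl ltW.
  by exfalso; apply: (no0 z w); rewrite // zl ltW.
case=> Dz zw.
have [Pw w0] := (complementP w).1 Dw; have [Pz z0] := (complementP z).1 Dz.
pose B := (fun e : R => w + e *: (z - w)) @` `[0, 1].
have : B z by exists 1; rewrite /= ?in_itv /= ?ler01 ?lexx // scale1r subrKC.
apply: connected_component_max.
- by exists 0; rewrite /= ?in_itv /= ?ler01 ?lexx // scale0r addr0.
- move=> _ [e /= /itvP e01 <-]; apply/complementP.
  have e0 : 0 <= e by rewrite e01.
  have e1 : 0 <= 1 - e by rewrite subr_ge0 e01.
  split=> [|l lA]; first by rewrite line_conv; apply: convex_unit_cube; rewrite // subrK.
  rewrite offset_val_line; have := w0 l lA; have := z0 l lA; have := zw l lA.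
  case: (ltgtP (offset_val z l) 0) => // zl; case: (ltgtP (offset_val w l) 0) => // wl _ _ _.
    by apply: ltr0_neq0; nra.
  by apply: lt0r_neq0; nra.
- apply: connected_continuous_connected; first exact: segment_connected.
  by apply: continuous_subspaceT; exact: line_continuous.
Qed.

Lemma closure_cell_side w x l : D w -> closure (cell w) x -> l \in A ->
  offset_val x l != 0 -> (0 < offset_val x l) = (0 < offset_val w l).
Proof.
move=> Dw wx lA xl; have [z [[Dz zw] /same_side ->]] := wx _ (near_same_side xl).
exact: zw.
Qed.

Let A_at (x : 'rV[R]_n) := [seq l <- A | form_val (x - centre n) l == 0].

Lemma mem_A_at x l : (l \in A_at x) = (offset_val x l == 0) && (l \in A).
Proof. by rewrite mem_filter. Qed.

(** Every region of the arrangement of the hyperplanes through [x] extends to a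
    region of the cube having [x] in its closure.  The direction [w] is moved to
    the centre of all hyperplanes and shrunk into the cube, giving w' with the
    same signs; then the points x + e (w' - x) stay in the cube even if [x]
    is on its boundary, have the signs of [w] on the forms vanishing at [x], and
    for small e keep the signs of [x] on the others. *)
Lemma nearby_region (x w : 'rV[R]_n) : unit_cube R n x -> avoids (A_at x) w ->
  exists z, [/\ D z, closure (cell z) x & signs (A_at x) (z - centre n) = signs (A_at x) w].
Proof.
move=> Px /allP wA.
have Pc : nbhs (centre n) (unit_cube R n).
  change ((unit_cube R n)° (centre n)); rewrite interior_unit_cube => i /=.
  by rewrite mxE; apply/andP; split; lra.
have [d d0 dP] := near_line w Pc.
pose w' := centre n + d *: w.
have Pw' : unit_cube R n w'.
  by apply: dP; rewrite gtr0_norm.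
have w'E l : offset_val w' l = d * form_val w l.
  by rewrite /offset_val /w' addrAC subrr add0r form_valZ.
have : \forall z \near x, {in A, forall l, offset_val x l != 0 ->
    0 < offset_val x l * offset_val z l}.
  elim: (A) => [|l B IH]; first by near=> z.
  have : \forall z \near x, offset_val x l != 0 -> 0 < offset_val x l * offset_val z l.
    have [x0|x0] := boolP (offset_val x l == 0); first by near=> z.
    by apply: filterS (near_same_side x0).
  move=> Nl; near=> z => m; rewrite inE => /orP[/eqP ->|].
    by near: z.
  by move: m; near: z.
move=> /(near_line (w' - x))[d2 d20 d2P].
pose y e := x + e *: (w' - x).
have yE e l : offset_val (y e) l = (1 - e) * offset_val x l + e * offset_val w' l.
  exact: offset_val_line.
pose e0 := Num.min d2 2^-1.
have [e00 e02 e01] : [/\ 0 < e0, e0 <= d2 & e0 < 1].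
  by rewrite /e0; case: (lerP d2 2^-1) => ?; split; lra.
have side e l : 0 < e <= e0 -> l \in A ->
    [/\ offset_val x l = 0 -> (0 < offset_val (y e) l) = (0 < form_val w l),
        offset_val x l != 0 -> (0 < offset_val (y e) l) = (0 < offset_val x l) &
        offset_val (y e) l != 0].
  case/andP=> e_0 e_e0 lA; have [x0|x0] := eqVneq (offset_val x l) 0.
    have wl : form_val w l != 0 by apply: wA; rewrite mem_A_at x0 eqxx.
    have ed : 0 < e * d by rewrite mulr_gt0.
    rewrite yE x0 mulr0 add0r w'E mulrA; split=> // [_|].
      by rewrite pmulr_rgt0.
    by rewrite mulf_neq0 // gt_eqF.
  have /d2P/(_ l lA x0) h : `|e| <= d2 by rewrite gtr0_norm // (le_trans e_e0).
  split=> // [x0'|_|]; first by rewrite x0' eqxx in x0.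
    by rewrite (same_side h).
  by apply: contraTneq h => ->; rewrite mulr0 ltxx.
have Py e : 0 < e <= e0 -> unit_cube R n (y e).
  case/andP=> ? ?; rewrite /y line_conv.
  by apply: convex_unit_cube; rewrite ?subrK //; lra.
have Dy e : 0 < e <= e0 -> D (y e).
  move=> he; apply/complementP; split=> [|l lA]; first exact: Py.
  by have [] := side e l he lA.
have e0e0 : 0 < e0 <= e0 by rewrite e00 lexx.
exists (y e0); split; first exact: Dy.
- move=> B /(near_line (w' - x))[d3 d30 d3P].
  pose e := Num.min d3 e0.
  have [e_0 e_d3 e_e0] : [/\ 0 < e, e <= d3 & e <= e0].
    by rewrite /e; case: (lerP d3 e0) => ?; split; lra.
  have he : 0 < e <= e0 by rewrite e_0.
  exists (y e); split; last first.
    by apply: d3P; rewrite gtr0_norm.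
  split=> [|l lA]; first exact: Dy.
  have [s1 s2 _] := side e l he lA; have [t1 t2 _] := side e0 l e0e0 lA.
  have [x0|x0] := eqVneq (offset_val x l) 0; first by rewrite s1 ?t1.
  by rewrite s2 ?t2.
- apply/eq_in_map => l; rewrite mem_A_at => /andP[/eqP x0 lA].
  by have [-> //] := side e0 l e0e0 lA.
Unshelve. all: by end_near.
Qed.

(** The signs on the forms vanishing at [x] determine a closed region through
    [x], since the remaining signs are those of [x]; [loc s] is this region.
    Distinct sign vectors give distinct closures, because the strict signs at a
    point of one region are the signs of any region whose closure contains that
    point. *)
Lemma multiplicity_regions x : unit_cube R n x ->
  multiplicity (unit_cube R n) H x = regions (A_at x) (setT : set 'rV[R]_n).
Proof.
move=> Px; rewrite /multiplicity mem_set //.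
pose loc s := closure [set z | [/\ D z,
  signs (A_at x) (z - centre n) = s &
  {in A, forall l, offset_val x l != 0 -> (0 < offset_val z l) = (0 < offset_val x l)}]].
have cell_loc z : D z -> closure (cell z) x ->
    closure (cell z) = loc (signs (A_at x) (z - centre n)).
  move=> Dz zx; congr closure; apply/seteqP; split=> u.
    case=> Du uz; split=> // [|l lA x0].
      by apply/eq_in_map => l; rewrite mem_A_at => /andP[_]; exact: uz.
    by rewrite uz // (closure_cell_side Dz zx).
  case=> Du /eq_in_map us ux; split=> // l lA.
  have [x0|x0] := eqVneq (offset_val x l) 0.
    by apply: us; rewrite mem_A_at x0 eqxx.
  by rewrite ux // (closure_cell_side Dz zx).
rewrite /regions -(size_map loc); apply: card_set_seq => [|C].
  rewrite map_inj_in_uniq ?sign_vectors_uniq //.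
  move=> s t /sign_vectorsP[w [_ ws ->]] /sign_vectorsP[v [_ vs ->]].
  have [z [Dz zx zs]] := nearby_region Px ws.
  have [u [Du ux us]] := nearby_region Px vs.
  rewrite -zs -us -!cell_loc // => zu.
  have uz : closure (cell u) z by rewrite -zu; apply: subset_closure; split.
  apply/eq_in_map => l; rewrite mem_A_at => /andP[_ lA].
  apply: (closure_cell_side Du uz lA).
  by have [_] := (complementP z).1 Dz; exact.
split.
  case=> -[z Dz <-]; rewrite component_cell // => zx.
  rewrite cell_loc //; apply: map_f; apply/sign_vectorsP.
  exists (z - centre n); split=> //; apply/allP => l.
  by rewrite mem_A_at => /andP[_]; have [_] := (complementP z).1 Dz; exact.
case/mapP=> s /sign_vectorsP[w [_ ws ->]] ->.
have [z [Dz zx <-]] := nearby_region Px ws.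
rewrite -cell_loc //; split=> //.
by exists z => //; rewrite component_cell.
Qed.

End Multiplicity.
End Geometry.

Arguments centre R n : clear implicits.

(** * Quasipolynomials are determined by their positive values *)

Lemma poly_eq_of_inf (p q : {poly rat}) (f : nat -> rat) (N : nat) : injective f ->
  (forall k : nat, (N <= k)%N -> p.[f k] = q.[f k]) -> p = q.
Proof.
move=> injf pq; apply/eqP; rewrite -subr_eq0; apply: contraT => d0.
pose s := [seq f (N + k)%N | k <- iota 0 (size (p - q))].
have us : uniq s.
  by rewrite map_inj_uniq ?iota_uniq // => i j /injf /addnI.
have rs : all (root (p - q)) s.
  apply/allP => _ /mapP[k _ ->]; rewrite /root hornerD hornerN pq ?subrr //.
  exact: leq_addr.
by have := max_poly_roots d0 rs us; rewrite size_map size_iota ltnn.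
Qed.

(** On a progression whose step is a multiple of all the periods the
    coefficients are constant, so the quasipolynomial is a polynomial there. *)
Lemma quasipolynomial_progression (q : int -> rat) : quasipolynomial q ->
  exists2 N : nat, (0 < N)%N & forall (M : nat) (t : int), (N %| M)%N ->
    exists p : {poly rat}, forall k : nat,
      q (t + (k * M)%:Z) = p.[(t + (k * M)%:Z)%:~R].
Proof.
case=> d [c [/fin_all_exists2[per per0 cper] qE]].
exists (\prod_i per i)%N; first exact: prodn_gt0.
move=> M t NM; exists (\poly_(j < d) (if insub j is Some i then c i t else 0)) => k.
rewrite qE horner_poly; apply: eq_bigr => i _; rewrite valK.
congr (_ * _).
have /dvdnP[m ->] : (per i %| k * M)%N.
  by apply/dvdn_mull/(dvdn_trans _ NM); rewrite (bigD1 i) //= dvdn_mulr.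
elim: m => [|m IH]; first by rewrite mul0n addr0.
by rewrite mulSn addnC PoszD addrA cper.
Qed.

Lemma quasipolynomial_unique (q r : int -> rat) :
  quasipolynomial q -> quasipolynomial r ->
  (forall t : nat, (0 < t)%N -> q t%:Z = r t%:Z) -> q =1 r.
Proof.
move=> /quasipolynomial_progression[N N0 qN] /quasipolynomial_progression[M M0 rM].
move=> qr t.
have [p pE] := qN (N * M)%N t (dvdn_mulr _ (dvdnn _)).
have [p' pE'] := rM (N * M)%N t (dvdn_mull _ (dvdnn _)).
have NM0 : (0 < N * M)%N by rewrite muln_gt0 N0.
have pp' : p = p'.
  apply: (@poly_eq_of_inf _ _ (fun k => (t + (k * (N * M))%:Z)%:~R) `|t|.+1).
    move=> i j /(@intr_inj rat) /addrI [] /eqP.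
    by rewrite eqn_pmul2r // => /eqP.
  move=> k tk; rewrite -pE -pE'.
  have [m mE m0] : exists2 m : nat, t + (k * (N * M))%:Z = m%:Z & (0 < m)%N.
    have := leq_pmulr k NM0; move: (k * _)%N => w kw.
    by exists (absz (t + w%:Z)%R); lia.
  by rewrite mE qr.
by have := pE 0%N; rewrite mul0n addr0 => ->; have := pE' 0%N; rewrite mul0n addr0 pp'.
Qed.

Lemma parity_quasipolynomial (P : bool -> {poly rat}) :
  quasipolynomial (fun t => (P (2 %| t)%Z).[t%:~R]).
Proof.
exists (maxn (size (P true)) (size (P false))).
exists (fun i t => (P (2 %| t)%Z)`_i); split.
  by move=> i; exists 2%N => // t; rewrite (rpredDr (x := 2%:Z)) ?dvdzz.
move=> t; apply: horner_coef_wide.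
by case: (2 %| t)%Z; rewrite ?leq_maxl ?leq_maxr.
Qed.

(** * Lattice points and colorings as grid points *)

Section Counting.
Variable R : realType.

Lemma card_set_fsum (T : choiceType) (A : set T) :
  card_set A = \sum_(x \in A) 1%N.
Proof.
rewrite /card_set card_fset_sum1 /finite_support locked_withE.
by rewrite (_ : A `&` _ = A) //; apply/seteqP; split=> x // [].
Qed.

Lemma card_set_bij (T U : choiceType) (A : set T) (B : set U) (h : T -> U) :
  set_bij A B h -> card_set A = card_set B.
Proof. by move=> hb; rewrite !card_set_fsum (reindex_fsbig _ _ _ _ hb). Qed.

Lemma open_count_card n (S : seq R) (A : seq (edge_form n)) :
  open_count S A = card_set (grid n S `&` [set y | avoids A y]).
Proof.
rewrite card_set_fsum /open_count fsbig_mkcondr; apply: eq_fsbigr => y _.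
by case: ifPn; rewrite ?inE ?notin_setE => /=; case: avoids.
Qed.

Definition form_of_edge n (e : signed_edge n) : edge_form n :=
  match e with
  | Link i j _ s => (Some (j, false), Some (i, s))
  | Loop i s => (Some (i, false), Some (i, s))
  | Halfedge i => (Some (i, false), None)
  | Loose_edge => (None, None)
  end.

Lemma edge_hyperplaneE n (e : signed_edge n) (x : 'rV[R]_n) :
  edge_hyperplane R e x <-> form_val x (form_of_edge e) = 0.
Proof.
have eqE (u v : R) : u = v <-> u - v = 0.
  by split=> [->|/eqP]; rewrite ?subrr ?subr_eq0 // => /eqP.
case: e => [i j ij s|i s|i|]; rewrite /form_val /= ?expr0 ?mul1r ?subr0 //.
Qed.

Definition forms n (Sigma : signed_graph n) : seq (edge_form n) :=
  [seq form_of_edge (edge_kind e) | e <- enum (edge Sigma)].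

Section Sigma.
Variables (n : nat) (Sigma : signed_graph n).

Lemma union_arrangement (x : 'rV[R]_n) :
  union_arr (arrangement R Sigma) x <-> ~~ avoids (forms Sigma) x.
Proof.
rewrite -has_predC has_map; split=> [[_ [e _ <-] /edge_hyperplaneE xe]|].
  by apply/hasP; exists e; rewrite ?mem_enum //= xe eqxx.
case/hasP=> e _ /=; rewrite negbK => /eqP/edge_hyperplaneE xe.
by exists (edge_hyperplane R (edge_kind e)) => //; exists e.
Qed.

Lemma union_shifted_arrangement (z : 'rV[R]_n) :
  union_arr (shifted_arrangement R Sigma) z <->
  ~~ avoids (forms Sigma) (z - centre R n).
Proof.
rewrite -union_arrangement; split=> [[_ [h hH <-] [x hx <-]]|[h hH hz]].
  by rewrite addrK; exists h.
exists [set x + const_mx 2^-1 | x in h]; first by exists h.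
by exists (z - centre R n) => //; rewrite subrK.
Qed.

(** The numbers k / t - 1/2 with m <= k <= t - m: the coordinates, relative to
    the centre, of the points of t^-1 Z in [0, 1] for m = 0, in the open
    interval for m = 1. *)
Definition colours (t m : nat) : seq R :=
  [seq k%:R / t%:R - 2^-1 | k <- iota m (t.+1 - 2 * m)].

Lemma coloursP (t m : nat) (u : R) : (0 < t)%N ->
  u \in colours t m <->
  exists2 z : int, u + 2^-1 = t%:R^-1 * z%:~R & m%:Z <= z <= t%:Z - m%:Z.
Proof.
move=> t0; split=> [/mapP[k]|[z uz /andP[mz zt]]].
  rewrite mem_iota => k_m ->; exists k%:Z; last lia.
  by rewrite subrK mulrC.
apply/mapP; exists (absz z); first by rewrite mem_iota; lia.
rewrite -[LHS](addrK 2^-1) uz mulrC; congr (_ / _ - _).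
by rewrite -[LHS](_ : (absz z)%:Z%:~R = _) //; congr (_%:~R); lia.
Qed.

Lemma colours_uniq t m : (0 < t)%N -> uniq (colours t m).
Proof.
move=> t0; rewrite map_inj_uniq ?iota_uniq // => i j /addIr.
have t1 : (t%:R : R)^-1 != 0 by rewrite invr_eq0 pnatr_eq0 -lt0n.
by move=> /(mulIf t1) /eqP; rewrite eqr_nat => /eqP.
Qed.

Lemma colours_sym t m : (0 < t)%N -> {in colours t m, forall s, - s \in colours t m}.
Proof.
move=> t0 s /(coloursP _ _ t0)[z sz zt]; apply/(coloursP _ _ t0).
have t1 : (t%:R : R) != 0 by rewrite pnatr_eq0 -lt0n.
exists (t%:Z - z); last lia.
rewrite rmorphB mulrBr -sz /= mulVf //; lra.
Qed.

(** k / t = 1/2 has an integer solution exactly when t is even; the bound on [m]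
    keeps k = t / 2 in the range. *)
Lemma colours0 t m : (0 < t)%N -> (m <= 1)%N -> (0 \in colours t m) = (2 %| t%:Z)%Z.
Proof.
move=> t0 m1; apply/idP/idP.
  case/(coloursP _ _ t0) => z; rewrite add0r => zt _; apply/dvdzP; exists z.
  apply: (@intr_inj R); rewrite intrM.
  have t1 : (t%:R : R) != 0 by rewrite pnatr_eq0 -lt0n.
  have : z%:~R = t%:R * 2^-1 :> R by rewrite zt mulrA mulfV ?mul1r.
  by move=> ->; rewrite -mulrA mulVf ?mulr1 // pnatr_eq0.
case/dvdzP=> z tz; apply/(coloursP _ _ t0); exists z; last lia.
have -> : (t%:R : R) = z%:~R * 2 by rewrite -[LHS]/(t%:Z%:~R) tz intrM.
rewrite add0r invfM mulrAC mulVf ?mul1r // intr_eq0; lia.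
Qed.

Lemma latticeP (t : nat) (x : 'rV[R]_n) :
  lattice t x <-> forall i, exists z : int, x ord0 i = t%:R^-1 * z%:~R.
Proof.
split=> [[z ->] i|/fin_all_exists[z zx]].
  by exists (z ord0 i); rewrite !mxE.
by exists (\row_i z i); apply/rowP => i; rewrite !mxE.
Qed.

Lemma grid_closed t (y : 'rV[R]_n) : (0 < t)%N ->
  grid n (colours t 0) y <->
  lattice t (y + centre R n) /\ unit_cube R n (y + centre R n).
Proof.
move=> t0; have t1 : (0 : R) < t%:R by rewrite ltr0n.
rewrite latticeP /unit_cube /grid /=; split=> [yS|[yL yP] i].
  split=> i; have /(coloursP _ _ t0)[z zy zt] := yS i; rewrite !mxE.
    by exists z.
  rewrite zy mulrC divr_ge0 ?ler0n ?ler0z //=; last by case/andP: zt.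
  by rewrite ler_pdivrMr // mul1r -[leRHS]/(t%:Z%:~R) ler_int; lia.
have := yP i; have [z] := yL i; rewrite !mxE => zy.
rewrite zy mulrC => /andP[z0 z1]; apply/(coloursP _ _ t0); exists z => //.
rewrite ler_pdivrMr // mul1r -[leRHS]/(t%:Z%:~R) ler_int in z1.
rewrite pmulr_lge0 ?invr_gt0 // ler0z in z0; lia.
Qed.

(** For points of t^-1 Z^n, being interior to the cube means that the numerators
    lie between 1 and t - 1. *)
Lemma grid_open t (y : 'rV[R]_n) : (0 < t)%N ->
  grid n (colours t 1) y <->
  lattice t (y + centre R n) /\ (unit_cube R n)° (y + centre R n).
Proof.
move=> t0; have t1 : (0 : R) < t%:R by rewrite ltr0n.
rewrite latticeP interior_unit_cube /grid /=; split=> [yS|[yL yP] i].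
  split=> i; have /(coloursP _ _ t0)[z zy zt] := yS i; rewrite !mxE.
    by exists z.
  rewrite zy mulrC divr_gt0 ?ltr0z //=; last lia.
  by rewrite ltr_pdivrMr // mul1r -[ltRHS]/(t%:Z%:~R) ltr_int; lia.
have := yP i; have [z] := yL i; rewrite !mxE => zy.
rewrite zy mulrC => /andP[z0 z1]; apply/(coloursP _ _ t0); exists z => //.
rewrite ltr_pdivrMr // mul1r -[ltRHS]/(t%:Z%:~R) ltr_int in z1.
rewrite pmulr_lgt0 ?invr_gt0 // ltr0z in z0; lia.
Qed.

Lemma shift_bij (B C : set 'rV[R]_n) :
  (forall y, B y <-> C (y + centre R n)) -> set_bij B C (fun y => y + centre R n).
Proof.
move=> BC; split=> [y /BC //|x y _ _ /addIr //|x Cx].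
by exists (x - centre R n); rewrite ?BC subrK.
Qed.

Lemma open_ehrhartE t : (0 < t)%N ->
  open_ehrhart (unit_cube R n) (shifted_arrangement R Sigma) t =
  open_count (colours t 1) (forms Sigma).
Proof.
move=> t0; rewrite open_count_card /open_ehrhart; apply/esym/card_set_bij.
apply: shift_bij => y; rewrite /setI /setD /= union_shifted_arrangement addrK.
rewrite (grid_open _ t0); split=> [[[yL yP] yA]|[yL [yP /negP]]].
  by split=> //; split=> //; apply/negP; rewrite negbK.
by rewrite negbK.
Qed.

Lemma ehrhartE t : (0 < t)%N ->
  ehrhart (unit_cube R n) (shifted_arrangement R Sigma) t =
  closed_count (colours t 0) (forms Sigma).
Proof.
move=> t0; rewrite /ehrhart /closed_count.
rewrite -(@fsbig_widen _ _ _ _ (lattice t `&` unit_cube R n)); last 2 first.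
- by move=> x [].
- move=> x [xL /= xP]; rewrite /multiplicity ifF //; apply/negbTE.
  by rewrite notin_setE => Px; apply: xP; split.
rewrite (reindex_fsbig _ _ _ _ (shift_bij (fun y => grid_closed y t0))).
apply: eq_fsbigr => y; rewrite inE => /(grid_closed _ t0)[_ yP] /=.
rewrite (multiplicity_regions (A := forms Sigma)) ?addrK //.
exact: union_shifted_arrangement.
Qed.

Definition integers (c : nat) : seq R :=
  [seq (k%:Z - c%:Z)%:~R | k <- iota 0 (2 * c + 1)].

Lemma integersP c u :
  u \in integers c <-> exists2 z : int, u = z%:~R & - c%:Z <= z <= c%:Z.
Proof.
split=> [/mapP[k]|[z -> zc]].
  by rewrite mem_iota => k_c ->; exists (k%:Z - c%:Z) => //; lia.
apply/mapP; exists (absz (z + c%:Z)); first by rewrite mem_iota; lia.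
by congr (_%:~R); lia.
Qed.

Lemma integers_uniq c : uniq (integers c).
Proof.
rewrite map_inj_uniq ?iota_uniq // => i j /intr_inj /addIr.
by case.
Qed.

Lemma integers_sym c : {in integers c, forall s, - s \in integers c}.
Proof.
move=> s /integersP[z -> zc]; apply/integersP; exists (- z); last lia.
by rewrite rmorphN.
Qed.

Lemma integers0 c : 0 \in integers c.
Proof. by apply/integersP; exists 0 => //; lia. Qed.

Lemma coloring_bij (B : set {ffun 'I_n -> int}) (S : seq R) :
  (forall x, B x <-> grid n S (\row_i (x i)%:~R) /\ proper_coloring R Sigma x) ->
  (forall u, u \in S -> exists z : int, u = z%:~R) ->
  card_set B = open_count S (forms Sigma).
Proof.
move=> BS Sz; rewrite open_count_card.
apply: (@card_set_bij _ _ _ _ (fun x : {ffun 'I_n -> int} => \row_i (x i)%:~R)).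
have proper x : proper_coloring R Sigma x <->
    avoids (forms Sigma) (\row_i ((x i)%:~R : R)).
  rewrite /proper_coloring union_arrangement.
  by split=> [/negP|xA]; [rewrite negbK|apply/negP; rewrite negbK].
split=> [x|x y _ _ /rowP xy|y [yS yA]].
- by rewrite BS proper.
- by apply/ffunP => i; have := xy i; rewrite !mxE => /intr_inj.
- have /fin_all_exists[z zy] i := Sz _ (yS i).
  have yE : \row_i ([ffun i => z i] i)%:~R = y.
    by apply/rowP => i; rewrite mxE ffunE -zy.
  by exists [ffun i => z i] => //; rewrite BS proper yE.
Qed.

Lemma coloringE c :
  card_set [set x : {ffun 'I_n -> int} | coloring c x /\ proper_coloring R Sigma x] =
  open_count (integers c) (forms Sigma).
Proof.
apply: coloring_bij => [x|u /integersP[z -> _]]; last by exists z.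
split=> -[xc xp]; split=> // i; have := xc i.
  by move=> h; apply/integersP; exists (x i); rewrite ?mxE.
by rewrite mxE => /integersP[z /intr_inj -> ].
Qed.

Lemma zero_free_coloringE c :
  card_set [set x : {ffun 'I_n -> int} |
    [/\ coloring c x, proper_coloring R Sigma x & zero_free x]] =
  open_count (rem 0 (integers c)) (forms Sigma).
Proof.
have remP u : u \in rem 0 (integers c) <-> u != 0 /\ u \in integers c.
  by rewrite mem_rem_uniq ?integers_uniq // inE; split=> /andP.
apply: coloring_bij => [x|u /remP[_ /integersP[z -> _]]]; last by exists z.
split=> [[xc xp x0]|[xc xp]]; first split=> // i.
  apply/remP; rewrite mxE intr_eq0; split; first exact: x0.
  by apply/integersP; exists (x i).
split=> // i; have /remP[] := xc i; rewrite mxE intr_eq0 //.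
by move=> _ /integersP[z /intr_inj -> ].
Qed.

End Sigma.
End Counting.

Theorem theorem5p6 (R : realType) (n : nat) (Sigma : signed_graph n) :
  let P := unit_cube R n in
  let H := shifted_arrangement R Sigma in
  [/\ exists E, quasipolynomial_of (ehrhart P H) E,
      exists Eo, quasipolynomial_of (open_ehrhart P H) Eo,
      exists chi, chromatic_polynomial R Sigma chi,
      exists chis, zero_free_chromatic_polynomial R Sigma chis &
      forall (E Eo : int -> rat) (chi chis : {poly rat}),
        quasipolynomial_of (ehrhart P H) E ->
        quasipolynomial_of (open_ehrhart P H) Eo ->
        chromatic_polynomial R Sigma chi ->
        zero_free_chromatic_polynomial R Sigma chis ->
        forall t : int,
          (-1) ^+ n * E (- t) = Eo t /\
          Eo t = (if (2 %| t)%Z then chi.[(t - 1)%:~R]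
                  else chis.[(t - 1)%:~R])].
Proof.
move=> P H.
have [p pP] : exists p : bool -> {poly rat}, forall b (S : seq R), uniq S ->
    {in S, forall s, - s \in S} -> (0 \in S) = b ->
    (open_count S (forms Sigma))%:R = (p b).[(size S)%:R] /\
    (closed_count S (forms Sigma))%:R = (-1) ^+ n * (p b).[- (size S)%:R].
  have [p1 H1] := count_reciprocity R (forms Sigma) true.
  have [p0 H0] := count_reciprocity R (forms Sigma) false.
  by exists (fun b => if b then p1 else p0) => -[].
(* The open grid has size t - 1, the closed one t + 1, both with 0 iff 2 | t. *)
pose Eo t := (p (2 %| t)%Z).[(t - 1)%:~R].
pose E t := (-1) ^+ n * (p (2 %| t)%Z).[- (t + 1)%:~R].
have EoQ : quasipolynomial_of (open_ehrhart P H) Eo.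
  split.
    have := parity_quasipolynomial (fun b => p b \Po ('X - 1)).
    congr quasipolynomial; apply/funext => t.
    by rewrite horner_comp hornerD hornerX hornerN hornerC /Eo rmorphB.
  move=> t t0; rewrite open_ehrhartE //.
  have [-> _] := pP _ _ (colours_uniq R 1 t0) (colours_sym t0) (colours0 R t0 (leqnn 1)).
  rewrite /Eo size_map size_iota; congr _.[_].
  by rewrite -[RHS]/(Posz _)%:~R; congr (_%:~R); lia.
have EQ : quasipolynomial_of (ehrhart P H) E.
  split.
    have := parity_quasipolynomial (fun b => (-1) ^+ n *: (p b \Po (- 'X - 1))).
    congr quasipolynomial; apply/funext => t; rewrite hornerZ /E.
    by rewrite horner_comp !(hornerD, hornerX, hornerN, hornerC) rmorphD opprD.
  move=> t t0; rewrite ehrhartE //.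
  have [_ ->] := pP _ _ (colours_uniq R 0 t0) (colours_sym t0) (colours0 R t0 (leq0n 1)).
  rewrite /E size_map size_iota; congr (_ * _.[- _]).
  by rewrite -[RHS]/(Posz _)%:~R; congr (_%:~R); lia.
have chiP : chromatic_polynomial R Sigma (p true).
  move=> c; rewrite coloringE.
  have [-> _] := pP _ _ (integers_uniq R c) (@integers_sym R c) (integers0 R c).
  by rewrite size_map size_iota.
have chisP : zero_free_chromatic_polynomial R Sigma (p false).
  move=> c; rewrite zero_free_coloringE.
  have uS := integers_uniq R c.
  have [| |-> _] := pP false _ (rem_uniq 0 uS).
  - move=> s; rewrite !mem_rem_uniq // !inE oppr_eq0 => /andP[-> sS] /=.
    exact: integers_sym.
  - by rewrite mem_rem_uniq // inE eqxx.
  - by rewrite size_rem ?integers0 // size_map size_iota addn1.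
split; [by exists E|by exists Eo|by exists (p true)|by exists (p false)|].
move=> E' Eo' chi chis [EQ' EE'] [EoQ' EoE'] chiP' chisP' t.
have -> : E' (- t) = E (- t).
  by apply: quasipolynomial_unique EQ' EQ.1 _ _ => k k0; rewrite EE' // EQ.2.
have -> : Eo' t = Eo t.
  by apply: quasipolynomial_unique EoQ' EoQ.1 _ _ => k k0; rewrite EoE' // EoQ.2.
have -> : chi = p true.
  apply: (@poly_eq_of_inf _ _ (fun c => (2 * c + 1)%:R) 0) => [i j /eqP|c _].
    by rewrite eqr_nat => /eqP; lia.
  by rewrite chiP'.
have -> : chis = p false.
  apply: (@poly_eq_of_inf _ _ (fun c => (2 * c)%:R) 0) => [i j /eqP|c _].
    by rewrite eqr_nat => /eqP; lia.
  by rewrite chisP'.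
split; last by rewrite /Eo; case: (2 %| t)%Z.
rewrite /E /Eo mulrA -exprMn mulrNN mulr1 expr1n mul1r dvdzE abszN -rmorphN.
by rewrite opprD opprK.
Qed.
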